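(* Let $n\ge 3$ and let $F_k$ be a free group of rank $k$. The image of any nontrivial homomorphism $\phi: WB_n\to F_k$ from the welded braid group $WB_n$ is infinite cyclic.
   Context: The welded braid group $WB_n$ is the group with generators $\sigma_i,\rho_i$ ($1\le i\le n-1$) and the following defining relations (for all indices for which they make sense): braid relations $\sigma_i\sigma_j=\sigma_j\sigma_i$ if $|i-j|>1$, $\sigma_i\sigma_{i+1}\sigma_i=\sigma_{i+1}\sigma_i\sigma_{i+1}$; symmetric relations $\rho_i^2=1$, $\rho_i\rho_j=\rho_j\rho_i$ if $|i-j|>1$, $\rho_i\rho_{i+1}\rho_i=\rho_{i+1}\rho_i\rho_{i+1}$; mixed relations $\sigma_i\rho_j=\rho_j\sigma_i$ if $|i-j|>1$, $\rho_i\rho_{i+1}\sigma_i=\sigma_{i+1}\rho_i\rho_{i+1}$; forbidden relations $\rho_i\sigma_{i+1}\sigma_i=\sigma_{i+1}\sigma_i\rho_{i+1}$. A homomorphism is nontrivial if its image is not the trivial group. *)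

(* Defs.v *)
From HB Require Import structures.
From mathcomp Require Import all_boot all_order all_algebra.
From mathcomp Require Import boolp classical_sets functions cardinality.

Set Implicit Arguments.
Unset Strict Implicit.
Unset Printing Implicit Defensive.

Local Open Scope group_scope.
Local Open Scope quotient_scope.
Local Open Scope classical_set_scope.

(* The letter (x, false) stands for the generator x, (x, true) for its inverse. *)
Notation word X := (seq (X * bool)).

Definition inv_letter (X : Type) (a : X * bool) : X * bool := (a.1, ~~ a.2).

Definition inv_word (X : Type) (u : word X) : word X := rev (map (@inv_letter X) u).

(* The congruence on words generated by R and free cancellation; cancelling
   a^-1 a is the case of the letter inv_letter a. *)
Inductive pres_eq (X : Type) (R : word X -> word X -> Prop) :
    word X -> word X -> Prop :=
| pres_eq_rel u v : R u v -> pres_eq R u v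
| pres_eq_cancel a : pres_eq R [:: a; inv_letter a] [::]
| pres_eq_cat u u' v v' :
    pres_eq R u u' -> pres_eq R v v' -> pres_eq R (u ++ v) (u' ++ v')
| pres_eq_refl u : pres_eq R u u
| pres_eq_sym u v : pres_eq R u v -> pres_eq R v u
| pres_eq_trans v u w : pres_eq R u v -> pres_eq R v w -> pres_eq R u w.

Section PresentedGroup.
Variables (X : choiceType) (R : word X -> word X -> Prop).

Definition pres_eqb : rel (word X) := fun u v => `[< pres_eq R u v >].

Lemma pres_eqb_refl : reflexive pres_eqb.
Proof. by move=> u; apply/asboolP; exact: pres_eq_refl. Qed.

Lemma pres_eqb_sym : symmetric pres_eqb.
Proof. by move=> u v; apply/asboolP/asboolP; exact: pres_eq_sym. Qed.

Lemma pres_eqb_trans : transitive pres_eqb.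
Proof.
by move=> v u w /asboolP uv /asboolP vw; apply/asboolP; exact: pres_eq_trans uv vw.
Qed.

Canonical pres_equiv : equiv_rel (word X) :=
  EquivRel pres_eqb pres_eqb_refl pres_eqb_sym pres_eqb_trans.

(* The group < X | u = v for all (u, v) in R >. *)
Definition presented_group := {eq_quot pres_equiv}.

HB.instance Definition _ := Choice.on presented_group.
HB.instance Definition _ := Quotient.on presented_group.
HB.instance Definition _ := EqQuotient.on presented_group.

Lemma pres_piP (u v : word X) :
  \pi_presented_group u = \pi_presented_group v <-> pres_eq R u v.
Proof. by split=> [/eqmodP/asboolP|/asboolP uv] //; apply/eqmodP. Qed.

Lemma pres_reprP (u : word X) : pres_eq R (repr (\pi_presented_group u)) u.
Proof. by apply/pres_piP; rewrite reprK. Qed.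

Lemma pres_eq_catV (u : word X) : pres_eq R (u ++ inv_word u) [::].
Proof.
elim: u => [|a u IHu]; first exact: pres_eq_refl.
rewrite /inv_word map_cons rev_cons -cats1 -cat1s -catA.
apply: (pres_eq_trans (v := [:: a] ++ ([::] ++ [:: inv_letter a]))).
  by apply: pres_eq_cat (pres_eq_refl _ _) _; rewrite catA;
     apply: pres_eq_cat IHu (pres_eq_refl _ _).
exact: pres_eq_cancel.
Qed.

Lemma inv_wordK : involutive (@inv_word X).
Proof.
move=> u; rewrite /inv_word map_rev revK -map_comp map_id_in //.
by case=> x b _ /=; rewrite /inv_letter /= negbK.
Qed.

Lemma pres_eq_catVw (u : word X) : pres_eq R (inv_word u ++ u) [::].
Proof. by rewrite -{2}[u]inv_wordK; exact: pres_eq_catV. Qed.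

Lemma pres_eq_inv (u v : word X) :
  pres_eq R u v -> pres_eq R (inv_word u) (inv_word v).
Proof.
move=> uv; apply: (pres_eq_trans (v := inv_word u ++ (v ++ inv_word v))).
  rewrite -{1}[inv_word u]cats0; apply: pres_eq_cat (pres_eq_refl _ _) _.
  exact/pres_eq_sym/pres_eq_catV.
rewrite catA -[X in pres_eq R _ X]cat0s.
apply: pres_eq_cat (pres_eq_refl _ _).
apply: pres_eq_trans (pres_eq_catVw u).
exact: pres_eq_cat (pres_eq_refl _ _) (pres_eq_sym uv).
Qed.

Definition pres_one : presented_group := \pi_presented_group [::].
Definition pres_mul (x y : presented_group) : presented_group :=
  \pi_presented_group (repr x ++ repr y).
Definition pres_inv (x : presented_group) : presented_group :=
  \pi_presented_group (inv_word (repr x)).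

Lemma pres_mulE u v :
  pres_mul (\pi_presented_group u) (\pi_presented_group v) =
  \pi_presented_group (u ++ v).
Proof. by apply/pres_piP; apply: pres_eq_cat; exact: pres_reprP. Qed.

Lemma pres_invE u :
  pres_inv (\pi_presented_group u) = \pi_presented_group (inv_word u).
Proof. by apply/pres_piP; apply: pres_eq_inv; exact: pres_reprP. Qed.

Lemma pres_mulA : associative pres_mul.
Proof.
move=> x y z; rewrite -[x]reprK -[y]reprK -[z]reprK.
rewrite (pres_mulE (repr y)) (pres_mulE (repr x) (repr y)).
by rewrite (pres_mulE (repr x)) (pres_mulE _ (repr z)) catA.
Qed.

Lemma pres_mul1 : left_id pres_one pres_mul.
Proof. by move=> x; rewrite -[x]reprK pres_mulE. Qed.

Lemma pres_mulr1 : right_id pres_one pres_mul.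
Proof. by move=> x; rewrite -[x]reprK pres_mulE cats0. Qed.

Lemma pres_mulV : left_inverse pres_one pres_inv pres_mul.
Proof.
move=> x; rewrite -[x]reprK pres_invE pres_mulE.
exact/pres_piP/pres_eq_catVw.
Qed.

Lemma pres_mulrV : right_inverse pres_one pres_inv pres_mul.
Proof.
move=> x; rewrite -[x]reprK pres_invE pres_mulE.
exact/pres_piP/pres_eq_catV.
Qed.

HB.instance Definition _ := isGroup.Build presented_group
  pres_mulA pres_mul1 pres_mulr1 pres_mulV pres_mulrV.

End PresentedGroup.

Definition free_group (X : choiceType) := @presented_group X (fun _ _ => False).
HB.instance Definition _ (X : choiceType) := Group.on (free_group X).

(* The generators sigma_{i+1} and rho_{i+1} (i < n - 1) are inl i and inr i. *)
Definition wb_gen (n : nat) : choiceType := ('I_n.-1 + 'I_n.-1)%type.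

Definition wb_sigma (n : nat) (i : 'I_n.-1) : wb_gen n * bool := (inl i, false).
Definition wb_rho (n : nat) (i : 'I_n.-1) : wb_gen n * bool := (inr i, false).

Section WeldedRelations.
Variable n : nat.
Local Notation s := (@wb_sigma n).
Local Notation r := (@wb_rho n).

Definition far (i j : 'I_n.-1) : bool := (i.+1 < j)%N || (j.+1 < i)%N.

Inductive wb_rel : word (wb_gen n) -> word (wb_gen n) -> Prop :=
| wb_sigma_far (i j : 'I_n.-1) : far i j -> wb_rel [:: s i; s j] [:: s j; s i]
| wb_sigma_braid (i j : 'I_n.-1) : j = i.+1 :> nat ->
    wb_rel [:: s i; s j; s i] [:: s j; s i; s j]
| wb_rho_sq (i : 'I_n.-1) : wb_rel [:: r i; r i] [::]
| wb_rho_far (i j : 'I_n.-1) : far i j -> wb_rel [:: r i; r j] [:: r j; r i]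
| wb_rho_braid (i j : 'I_n.-1) : j = i.+1 :> nat ->
    wb_rel [:: r i; r j; r i] [:: r j; r i; r j]
| wb_mixed_far (i j : 'I_n.-1) : far i j -> wb_rel [:: s i; r j] [:: r j; s i]
| wb_mixed (i j : 'I_n.-1) : j = i.+1 :> nat ->
    wb_rel [:: r i; r j; s i] [:: s j; r i; r j]
| wb_forbidden (i j : 'I_n.-1) : j = i.+1 :> nat ->
    wb_rel [:: r i; s j; s i] [:: s j; s i; r j].

End WeldedRelations.

Definition welded_braid_group (n : nat) := presented_group (@wb_rel n).
HB.instance Definition _ (n : nat) := Group.on (welded_braid_group n).

Definition expgz (G : groupType) (g : G) (m : int) : G :=
  match m with Posz k => g ^+ k | Negz k => g ^- k.+1 end.

Definition infinite_cyclic (G : groupType) (A : set G) : Prop :=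
  (exists g : G, A = range (expgz g)) /\ infinite_set A.

(* Main.v *)
Require Import Defs.
From HB Require Import structures.
From mathcomp Require Import all_boot all_order all_algebra.
From mathcomp Require Import boolp classical_sets functions cardinality.

(** Free groups have no torsion.  Each rho_i is an involution, so phi kills it,
    and then the mixed relation rho_i rho_(i+1) sigma_i = sigma_(i+1) rho_i
    rho_(i+1) forces phi to agree on consecutive sigma's.  Hence all the sigma's
    have one common image g and the image of phi is the cyclic group generated
    by g.  If phi is nontrivial then g <> 1, and g has infinite order, again
    because there is no torsion.

    That free groups are torsion-free ([free_group_torsion_free]) rests on two
    facts about words.  A reduced word which represents 1 is empty
    ([reduced_trivial]): the free group acts on reduced words by multiplying on
    the left and cancelling, and a reduced word is recovered from its action on
    the empty word.  And every element is conjugate to one given by a cyclically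
    reduced word; the powers of such a word are reduced, so none of them is
    trivial unless the word is empty. *)

Set Implicit Arguments.
Unset Strict Implicit.
Unset Printing Implicit Defensive.

Local Open Scope group_scope.
Local Open Scope quotient_scope.
Local Open Scope classical_set_scope.

Section Powers.
Variable G : groupType.
Implicit Type g : G.

Lemma expgzSl g m : exists m', g * expgz g m = expgz g m'.
Proof.
case: m => [k|[|k]] /=; first by exists (Posz k.+1); rewrite /= expgS.
  by exists (Posz 0); rewrite /= mulgV.
by exists (Negz k); rewrite /= (expgSr g k.+1) invgM mulgA mulgV mul1g.
Qed.

Lemma expgzPl g m : exists m', g^-1 * expgz g m = expgz g m'.
Proof.
case: m => [[|k]|k] /=; first by exists (Negz 0); rewrite /= mulg1.
  by exists (Posz k); rewrite /= (expgS g k) mulKg.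
by exists (Negz k.+1); rewrite /= -invgM -expgSr.
Qed.

(** The exponents k >= 0 already give infinitely many powers: if g^i = g^j with
    i < j, then g^(j - i) = 1. *)
Lemma infinite_range_expgz g :
  (forall m, g ^+ m.+1 <> 1) -> infinite_set (range (expgz g)).
Proof.
move=> g_inf fin.
have inj : injective (fun k : nat => g ^+ k).
  have lt i j : (i < j)%N -> g ^+ i <> g ^+ j.
    move=> ij e; apply: (g_inf (j - i).-1).
    by rewrite prednK ?subn_gt0 // expgnFr ?(ltnW ij) // e mulgV.
  by move=> i j /= e; case: (ltngtP i j) => // /lt; rewrite e.
apply: infinite_nat.
apply: sub_finite_set (finite_preimage (in2W inj) fin).
by move=> k _ /=; exists (Posz k).
Qed.

End Powers.

(** Over groups, preservation of products entails preservation of the unit,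
    inverses and powers, whereas [gmulf1], [gmulfV] and [gmulfXn] ask for a
    morphism that is packaged with a proof that it preserves the unit. *)
Section MultiplicativeOfGroups.
Variables (G H : groupType) (f : {multiplicative G -> H}).

Lemma multiplicative1 : f 1 = 1.
Proof. by apply: (mulgI (f 1)); rewrite -gmulfM !mulg1. Qed.

Lemma multiplicativeV x : f x^-1 = (f x)^-1.
Proof. by apply/esym/mulg1_eq; rewrite -gmulfM mulgV multiplicative1. Qed.

Lemma multiplicativeX x m : f (x ^+ m) = f x ^+ m.
Proof.
by elim: m => [|m IHm]; rewrite ?multiplicative1 // !expgS gmulfM IHm.
Qed.

Lemma range_expgz_multiplicative x : range (expgz (f x)) `<=` range f.
Proof.
move=> _ [m _ <-]; exists (expgz x m) => //.
by case: m => k /=; rewrite ?multiplicativeV multiplicativeX.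
Qed.

End MultiplicativeOfGroups.

Section PresentedGroupElements.
Variables (X : choiceType) (R : word X -> word X -> Prop).
Local Notation G := (presented_group R).

Definition pres_class (u : word X) : G := \pi_(presented_group R) u.

Lemma pres_class_cat u v : pres_class (u ++ v) = pres_class u * pres_class v.
Proof. by rewrite /pres_class -pres_mulE. Qed.

Lemma pres_class_rel u v : R u v -> pres_class u = pres_class v.
Proof. by move=> uv; apply/pres_piP; exact: pres_eq_rel. Qed.

Lemma pres_class_inv_letter a : pres_class [:: inv_letter a] = (pres_class [:: a])^-1.
Proof.
apply/esym/mulg1_eq; rewrite -pres_class_cat.
by apply/pres_piP; exact: pres_eq_cancel.
Qed.

(** Multiplication by g or g^-1 on the left preserves the powers of g, so an
    induction on words, one letter at a time, suffices. *)
Lemma presented_hom_cyclic (H : groupType) (f : {multiplicative G -> H}) (g : H) :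
    (forall x, f (pres_class [:: (x, false)]) = g
            \/ f (pres_class [:: (x, false)]) = 1) ->
  range f `<=` range (expgz g).
Proof.
move=> fgen _ [w _ <-]; rewrite -[w]reprK -/(pres_class (repr w)).
elim: (repr w) => [|a u [m _ IHu]].
  by exists (Posz 0) => //=; rewrite -[pres_class _]/(1 : G) multiplicative1.
suff [m' em'] : exists m', f (pres_class [:: a]) * expgz g m = expgz g m'.
  exists m' => //.
  by rewrite -em' IHu -gmulfM -pres_class_cat.
case: a => x b; have [fx|fx] := fgen x; case: b.
- by rewrite (pres_class_inv_letter (x, false)) multiplicativeV fx; exact: expgzPl.
- by rewrite fx; exact: expgzSl.
- by rewrite (pres_class_inv_letter (x, false)) multiplicativeV fx invg1 mul1g; exists m.
- by rewrite fx mul1g; exists m.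
Qed.

End PresentedGroupElements.

Lemma pathPn_split (T : Type) (e : rel T) x s : ~~ path e x s ->
  exists s1 b c s2, x :: s = s1 ++ [:: b, c & s2] /\ ~~ e b c.
Proof.
elim: s x => //= y s IHs x; rewrite negb_and => /orP[nxy|/IHs].
  by exists [::], x, y, s.
by case=> s1 [b [c [s2 [-> nbc]]]]; exists (x :: s1), b, c, s2.
Qed.

Section ReducedWords.
Variable X : choiceType.
Implicit Types (a b : X * bool) (u v w : word X).

Lemma inv_letterK : involutive (@inv_letter X).
Proof. by case=> x b; rewrite /inv_letter /= negbK. Qed.

Lemma inv_letter_neq a : a != inv_letter a.
Proof. by case: a => x b; rewrite xpair_eqE eqxx; case: b. Qed.

Definition noncancel : rel (X * bool) := fun a b => b != inv_letter a.
Definition reduced : pred (word X) := sorted noncancel.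

(** Left multiplication by the letter a, in terms of normal forms: the result is
    reduced as soon as w is. *)
Definition push a w : word X :=
  if w is b :: w' then if noncancel a b then a :: w else w' else [:: a].

Lemma reduced_push a w : reduced w -> reduced (push a w).
Proof.
case: w => //= b w bw; case: ifP => [ab|_] /=; first by rewrite ab.
exact: path_sorted bw.
Qed.

Lemma push_noncancel a w : reduced (a :: w) -> push a w = a :: w.
Proof. by case: w => //= b w /andP[->]. Qed.

Lemma pushK a w : reduced w -> push a (push (inv_letter a) w) = w.
Proof.
case: w => [|b w] /=; first by rewrite /noncancel eqxx.
rewrite /noncancel inv_letterK => bw.
have [eba|] /= := eqVneq b a; last by rewrite /noncancel eqxx.
by rewrite -eba; exact: push_noncancel.
Qed.

Definition word_act u w : word X := foldr push w u.

Lemma reduced_word_act u w : reduced w -> reduced (word_act u w).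
Proof. by move=> rw; elim: u => //= a u; exact: reduced_push. Qed.

(** By [pushK], a letter and its inverse act on reduced words by inverse maps,
    so the action factors through the free group.  The restriction to reduced w
    is essential: on w = a a^-1 ..., pushing a^-1 and then a cancels twice. *)
Lemma word_act_pres_eq u v :
  pres_eq (fun _ _ => False) u v ->
  forall w, reduced w -> word_act u w = word_act v w.
Proof.
elim=> {u v} //.
- by move=> a w rw /=; exact: pushK.
- move=> u u' v v' _ IHu _ IHv w rw.
  by rewrite /word_act !foldr_cat -!/(word_act _ _) IHv // IHu //
    reduced_word_act.
- by move=> u v _ IH w rw; rewrite IH.
- by move=> v u w _ IH1 _ IH2 x rx; rewrite IH1 // IH2.
Qed.

Lemma word_act_nil u : reduced u -> word_act u [::] = u.
Proof.
elim: u => //= a u IHu au; rewrite IHu; first exact: push_noncancel.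
exact: path_sorted au.
Qed.

Local Notation cls := (@pres_class X (fun _ _ => False)).

(** If u represents 1, it acts on the empty word as the identity; being reduced,
    it also sends the empty word to u. *)
Lemma reduced_trivial u : reduced u -> cls u = 1 -> u = [::].
Proof.
move=> ru /pres_piP eu.
by rewrite -(word_act_nil ru) (word_act_pres_eq eu).
Qed.

Lemma cls_pow u m : cls u ^+ m = cls (flatten (nseq m u)).
Proof. by elim: m => //= m IHm; rewrite expgS pres_class_cat IHm. Qed.

(** Being a cycle for [noncancel] says that the last letter does not cancel with
    the first one either, so no cancellation appears where copies of u meet. *)
Lemma cycle_reduced_pow u m :
  cycle noncancel u -> reduced (flatten (nseq m u)).
Proof.
case: u => [|a p cu]; first by elim: m.
suff: path noncancel (last a p) (flatten (nseq m (a :: p))).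
  exact: path_sorted.
elim: m => // m IHm; rewrite [flatten _]/= -cat_cons cat_path IHm andbT.
by move: cu; rewrite /= rcons_path andbC.
Qed.

(** A word that is not cyclically reduced has two cyclically adjacent letters
    that cancel.  If they are adjacent in u, deleting them does not change the
    element; if they are the two ends of u, deleting them conjugates it. *)
Lemma cyclic_shorten u : ~~ cycle noncancel u ->
  exists2 v, (size v < size u)%N & exists t, cls u = cls v ^ t.
Proof.
case: u => // a p ncu; have [s1 [b [c [s2 [e]]]]] := pathPn_split ncu.
rewrite negbK => /eqP ec.
have cancel2 : cls [:: b; c] = 1 by rewrite ec; apply/pres_piP/pres_eq_cancel.
(* The cycle is the path along u followed by its first letter a again; the
   cancelling pair uses this extra copy of a exactly when s2 is empty. *)
rewrite -rcons_cons in e; case/lastP: s2 e => [|s2 d].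
  rewrite -[[:: b; c]]cat1s catA !cats1 => /rcons_inj [eu ea].
  case: s1 eu => [|a' s1] [eab ->].
    (* A one-letter word would be its own inverse. *)
    by move: (inv_letter_neq a); rewrite {1}ea ec eab eqxx.
  exists s1; first by rewrite /= size_rcons ltnW.
  exists (cls [:: a])^-1.
  rewrite -cats1 -cat1s !pres_class_cat conjgE invgK.
  by rewrite ea ec pres_class_inv_letter invgK.
rewrite -!rcons_cons -rcons_cat => /rcons_inj[-> _].
exists (s1 ++ s2); first by rewrite !size_cat /= ltn_add2l ltnW.
exists 1; rewrite conjg1 -[[:: b, c & s2]]/([:: b; c] ++ s2).
by rewrite !pres_class_cat cancel2 mul1g.
Qed.

(** By induction on the length of a representing word: conjugation preserves the
    order of an element, so only cyclically reduced words matter, and their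
    positive powers are reduced words, trivial only for the empty word. *)
Lemma free_group_torsion_free (x : free_group X) m : x ^+ m.+1 = 1 -> x = 1.
Proof.
rewrite -[x]reprK -/(cls (repr x)); move: (repr x) => u {x}.
have [k] := ubnP (size u); elim: k u => // k IHk u; rewrite ltnS => uk xm.
have [cu|/cyclic_shorten[v vu [t et]]] := boolP (cycle noncancel u).
  rewrite cls_pow in xm.
  have := reduced_trivial (cycle_reduced_pow m.+1 cu) xm.
  by case: (u).
apply/eqP; rewrite et conjg_eq1; apply/eqP/IHk; first exact: leq_trans vu uk.
by apply/eqP; rewrite -(conjg_eq1 _ t) conjXg -et xm.
Qed.

End ReducedWords.

(** With the rho's sent to 1, the mixed relation reads sigma_i = sigma_(i+1). *)
Lemma welded_sigma_eq (n : nat) (H : groupType)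
    (phi : {multiplicative welded_braid_group n -> H}) :
    (forall i, phi (pres_class _ [:: wb_rho i]) = 1) ->
  forall i j, phi (pres_class _ [:: wb_sigma i]) = phi (pres_class _ [:: wb_sigma j]).
Proof.
move=> rho1.
have step (i j : 'I_n.-1) : j = i.+1 :> nat ->
    phi (pres_class _ [:: wb_sigma i]) = phi (pres_class _ [:: wb_sigma j]).
  move=> ij.
  have /(congr1 phi) := pres_class_rel (wb_mixed ij).
  rewrite -(cat1s (wb_rho i)) -(cat1s (wb_rho j) [:: wb_sigma i]).
  rewrite -(cat1s (wb_sigma j)) -(cat1s (wb_rho i) [:: wb_rho j]).
  by rewrite !pres_class_cat !gmulfM !rho1 !mul1g !mulg1.
have up k : forall i j : 'I_n.-1, (i + k)%N = j ->
    phi (pres_class _ [:: wb_sigma i]) = phi (pres_class _ [:: wb_sigma j]).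
  elim: k => [|k IHk] i j; first by rewrite addn0 => /val_inj ->.
  rewrite addnS => ij.
  have lt : (i + k < n.-1)%N by rewrite ltnW // ij.
  by rewrite (IHk i (Ordinal lt)) //; exact: step.
move=> i j; case: (leqP i j) => [ij|/ltnW ij].
  by apply: (up (j - i)%N); rewrite subnKC.
by apply/esym/(up (i - j)%N); rewrite subnKC.
Qed.

Theorem corollary1p3 (n k : nat) (hn : (3 <= n)%N)
    (phi : {multiplicative welded_braid_group n -> free_group 'I_k})
    (hphi : range phi <> [set 1%g]%classic) :
  infinite_cyclic (range phi).
Proof.
have rho1 i : phi (pres_class _ [:: wb_rho i]) = 1.
  apply: (@free_group_torsion_free _ _ 1).
  rewrite expg2 -gmulfM -pres_class_cat (pres_class_rel (wb_rho_sq i)).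
  exact: multiplicative1.
have i0_lt : (0 < n.-1)%N by case: n hn {phi hphi rho1} => [|[]].
pose i0 := Ordinal i0_lt; pose g := phi (pres_class _ [:: wb_sigma i0]).
have img : range phi = range (expgz g).
  apply/seteqP; split; last exact: range_expgz_multiplicative.
  apply: presented_hom_cyclic => -[i|i]; last by right; exact: rho1.
  by left; exact: welded_sigma_eq.
split; first by exists g.
rewrite img; apply: infinite_range_expgz => m /free_group_torsion_free g1.
apply: hphi; rewrite img g1; apply/seteqP; split=> [_ [z _ <-]|_ ->].
  by case: z => l /=; rewrite expg1n ?invg1.
by exists (Posz 0).
Qed.
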